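(* There is a function $\varepsilon:\mathbb{N}\to[0,\infty)$ with $\varepsilon(n)\to0$ as $n\to\infty$ such that for every $n$ there are permutations $\pi,\tau\in S_n$ with $d(\pi,\tau)=1$ and \[\Delta(\lambda(\pi),\lambda(\tau))\ge(1-\varepsilon(n))\sqrt{n/2}.\]
   Context: Permutations are written in one-line notation. For $\pi\in S_n$, $\lambda(\pi)$ denotes the shape of the tableaux associated with $\pi$ by the RSK correspondence. The distance $d(\pi,\tau)$ is the least number of adjacent transpositions $(k,k+1)$, $1\le k\le n-1$, whose successive left multiplication transforms $\pi$ into $\tau$. For partitions $\lambda,\mu$ of $n$ (parts padded with zeros), $\Delta(\lambda,\mu)=\frac12\sum_{i=1}^n|\lambda_i-\mu_i|$.
   Formalization: The claim is proved for every n ≥ 2; for n ≤ 1 the group S_n has only one element, so no permutations with d(π,τ)=1 exist and the statement fails there. *)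

(* Defs.v *)
From mathcomp Require Import all_boot all_fingroup.
From Stdlib Require Import Reals.
Set Implicit Arguments. Unset Strict Implicit. Unset Printing Implicit Defensive.

Definition one_line n (p : {perm 'I_n}) : seq nat := [seq val (p i) | i <- enum 'I_n].

Fixpoint rsk_ins (t : seq (seq nat)) (x : nat) : seq (seq nat) :=
  match t with
  | [::] => [:: [:: x]]
  | r :: t' =>
      let i := find (fun y => x < y) r in
      if i == size r then rcons r x :: t'
      else set_nth 0 r i x :: rsk_ins t' (nth 0 r i)
  end.

Definition rsk_P n (p : {perm 'I_n}) : seq (seq nat) := foldl rsk_ins [::] (one_line p).
Definition rsk_shape n (p : {perm 'I_n}) : seq nat := map size (rsk_P p).

(* Left multiplication by the adjacent transposition (k, k+1):
   sigma = s_k o p, i.e. sigma(i) = s_k(p(i)).  In mathcomp, (p * q) x = q (p x). *)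
Definition adj_left n (k : nat) (p : {perm 'I_n}) : {perm 'I_n} :=
  if (k.+1 < n) =P true is ReflectT h then
    p * tperm (Ordinal (ltnW h)) (Ordinal h)
  else p.

Definition reach_in n (pi tau : {perm 'I_n}) (m : nat) : Prop :=
  exists ks : seq nat, size ks = m /\ all (fun k => k.+1 < n) ks /\
    foldl (fun p k => adj_left k p) pi ks = tau.

Definition adj_dist_is n (pi tau : {perm 'I_n}) (m : nat) : Prop :=
  reach_in pi tau m /\ forall j, j < m -> ~ reach_in pi tau j.

Definition natdist (a b : nat) : nat := (a - b) + (b - a).
Definition DeltaPart (n : nat) (la mu : seq nat) : R :=
  (INR (\sum_(i < n) natdist (nth 0 la i) (nth 0 mu i)) / 2)%R.

(* Main.v *)
(** Write [m = M + 1] and let [diamond M] be the [2 m^2] points of a square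
    lattice diamond with rows of lengths 2, 4, ..., 2m, ..., 4, 2. Ordering its
    points by column and then downwards (positions), and by row and then to the
    right (values), reads it as a permutation in which rows are increasing and
    columns decreasing. The two central points of the middle row carry
    consecutive values; exchanging them turns the shape
    (2m, 2m-2, 2m-2, ..., 2, 2) into (2m-1, 2m-1, ..., 3, 3, 1, 1), so that the
    two shapes differ by 1 in each of the first 2m rows.

    Only Greene's inequalities are needed, not the shapes themselves: the sum of
    the first [k] row lengths is at least the size of any union of [k] increasing
    subsequences, and at most [k q] plus the number of letters missed by [q]
    disjoint decreasing subsequences. For odd [k] these are applied to the rows of
    the diamond before the exchange and to bent columns after it; for even [k] to
    the columns before and to bent rows after. *)

Require Import Defs.
From mathcomp Require Import all_boot all_fingroup zify.
From Stdlib Require Import Reals Lra.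
Set Implicit Arguments. Unset Strict Implicit. Unset Printing Implicit Defensive.

(** * Coloured words and Knuth moves *)

(* A coloured word is a list of pairs (letter, colour). Colours [>= k] mean
   "uncoloured"; in a valid colouring every colour class below [k] is weakly
   increasing, so the coloured letters are a union of [k] increasing subsequences. *)
Definition inc_rel k (p q : nat * nat) := (p.2 == q.2) && (p.2 < k) ==> (p.1 <= q.1).
Definition colours k (W : seq (nat * nat)) := pairwise (inc_rel k) W.
Definition ncol k (W : seq (nat * nat)) := count (fun p => p.2 < k) W.

Definition transfer (w w' : seq nat) := forall u v k W,
  map fst W = u ++ w ++ v -> colours k W ->
  exists W', [/\ map fst W' = u ++ w' ++ v, colours k W' & ncol k W' = ncol k W].

Lemma transfer_refl w : transfer w w.
Proof. by move=> u v k W eW cW; exists W. Qed.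

Lemma transfer_trans w2 w1 w3 : transfer w1 w2 -> transfer w2 w3 -> transfer w1 w3.
Proof.
move=> t12 t23 u v k W eW cW; have [W2 [e2 c2 n2]] := t12 u v k W eW cW.
by have [W3 [e3 c3 n3]] := t23 u v k W2 e2 c2; exists W3; rewrite n3.
Qed.

Lemma transfer_ctx a b w w' : transfer w w' -> transfer (a ++ w ++ b) (a ++ w' ++ b).
Proof.
move=> t u v k W; rewrite -!catA => eW cW.
have [|W' [e' c' n']] := t (u ++ a) (b ++ v) k W _ cW; first by rewrite eW -!catA.
by exists W'; rewrite e' -!catA.
Qed.

Lemma map_fst_cat3 (W : seq (nat * nat)) u w v : map fst W = u ++ w ++ v ->
  exists U X V, [/\ W = U ++ X ++ V, map fst U = u, map fst X = w & map fst V = v].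
Proof.
move=> e; exists (take (size u) W), (take (size w) (drop (size u) W)), (drop (size w) (drop (size u) W)).
by rewrite !cat_take_drop map_take !map_drop map_take map_drop e take_size_cat // drop_size_cat //
  take_size_cat // drop_size_cat.
Qed.

Lemma colours_cat3 k U X V : colours k (U ++ X ++ V) =
  [&& allrel (inc_rel k) U X, allrel (inc_rel k) U V, allrel (inc_rel k) X V,
      colours k U, colours k X & colours k V].
Proof.
by rewrite /colours !pairwise_cat allrel_catr -!andbA; do !bool_congr.
Qed.

(** Exchanging two colours in everything to the right of a point makes two chains trade their tails
    there. *)
Definition swapc (c d e : nat) := if e == c then d else if e == d then c else e.
Definition recolour c d (V : seq (nat * nat)) := [seq (p.1, swapc c d p.2) | p <- V].

Lemma swapc_lt c d k e : c < k -> d < k -> (swapc c d e < k) = (e < k).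
Proof. by rewrite /swapc => ck dk; case: eqP => [->|_]; [|case: eqP => [->|_]]; rewrite ?ck ?dk. Qed.

Lemma swapcK c d : involutive (swapc c d).
Proof.
move=> e; rewrite /swapc; case: (eqVneq e c) => [->|/negbTE ec].
  by rewrite eqxx; case: eqVneq.
by case: (eqVneq e d) => [->|/negbTE ed]; rewrite ?eqxx // ec ed.
Qed.

Lemma ncol_cat k U V : ncol k (U ++ V) = ncol k U + ncol k V.
Proof. exact: count_cat. Qed.

Lemma ncol_triple k U p q r V : ncol k (U ++ [:: p; q; r] ++ V) =
  ncol k U + ((p.2 < k) + (q.2 < k) + (r.2 < k)) + ncol k V.
Proof. by rewrite !ncol_cat /ncol /= addn0 !addnA. Qed.

Lemma ncol_recolour k c d V : c < k -> d < k -> ncol k (recolour c d V) = ncol k V.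
Proof. by move=> ck dk; rewrite /ncol count_map; apply: eq_count => p /=; rewrite swapc_lt. Qed.

Lemma fst_recolour c d V : map fst (recolour c d V) = map fst V.
Proof. by rewrite -map_comp. Qed.

Lemma colours_recolour k c d V : c < k -> d < k -> colours k (recolour c d V) = colours k V.
Proof.
move=> ck dk; rewrite /colours pairwise_map; apply: eq_pairwise => p q /=.
by rewrite /inc_rel /= swapc_lt // (inj_eq (inv_inj (@swapcK c d))).
Qed.

Lemma allrel_inc k U V : reflect
  (forall p q, p \in U -> q \in V -> p.2 = q.2 -> p.2 < k -> p.1 <= q.1)
  (allrel (inc_rel k) U V).
Proof.
apply: (iffP allrelP) => h p q pU qV.
  by move=> e l; have := h p q pU qV; rewrite /inc_rel e eqxx -e l.
by apply/implyP => /andP[/eqP e l]; apply: h.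
Qed.

Definition below k U (p : nat * nat) := all (fun q => inc_rel k q p) U.
Definition above k (p : nat * nat) V := all (inc_rel k p) V.

(** The grouping is chosen so that rearranging three coloured letters only permutes the [below] and
    [above] conditions; the last group alone can really change. *)
Lemma colours_triple k U p q r V : colours k (U ++ [:: p; q; r] ++ V) =
  [&& [&& colours k U, colours k V & allrel (inc_rel k) U V],
      [&& below k U p, below k U q & below k U r],
      [&& above k p V, above k q V & above k r V] &
      [&& inc_rel k p q, inc_rel k p r & inc_rel k q r]].
Proof.
rewrite colours_cat3 /colours /= !allrel_consl !allrel_consr allrel0l allrel0r /below /above /= !andbT.
by rewrite -!andbA; do !bool_congr.
Qed.

Lemma belowP k U p : reflect
  (forall q, q \in U -> q.2 = p.2 -> p.2 < k -> q.1 <= p.1) (below k U p).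
Proof.
apply: (iffP allP) => h q qU.
  by move=> e l; have := h q qU; rewrite /inc_rel e eqxx l.
by apply/implyP => /andP[/eqP e l]; apply: h; rewrite // -e.
Qed.

Lemma aboveP k V p : reflect
  (forall q, q \in V -> q.2 = p.2 -> p.2 < k -> p.1 <= q.1) (above k p V).
Proof.
apply: (iffP allP) => h q qV.
  by move=> e l; have := h q qV; rewrite /inc_rel -e eqxx e l.
by apply/implyP => /andP[/eqP e l]; apply: h.
Qed.

Lemma below_le k U x y c : x <= y -> below k U (x, c) -> below k U (y, c).
Proof. by move=> xy /belowP h; apply/belowP => q /h /= {}h e l; apply: leq_trans xy; apply: h. Qed.

Lemma above_le k V x y c : x <= y -> above k (y, c) V -> above k (x, c) V.
Proof. by move=> xy /aboveP h; apply/aboveP => q /h /= {}h e l; apply: (leq_trans xy); apply: h. Qed.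

Lemma below_uncoloured k U x c : k <= c -> below k U (x, c).
Proof. by move=> kc; apply/belowP => q _ _ /=; rewrite ltnNge kc. Qed.

Lemma above_uncoloured k V x c : k <= c -> above k (x, c) V.
Proof. by move=> kc; apply/aboveP => q _ _ /=; rewrite ltnNge kc. Qed.

Lemma above_recolour k V x e c d : c < k -> d < k ->
  above k (x, swapc c d e) V -> above k (x, e) (recolour c d V).
Proof.
move=> ck dk /aboveP h; apply/aboveP => _ /mapP[q qV ->] /= eq ek.
by apply: h => //=; [rewrite -eq swapcK|rewrite swapc_lt].
Qed.

(** After the exchange, a left letter of colour [d] meets the former [c]-tail, with [y] between them
    in value; likewise [x] separates colour [c] from the former [d]-tail. *)
Lemma allrel_recolour k U V x y c d : c < k -> d < k ->
  below k U (x, c) -> below k U (y, d) -> above k (x, d) V -> above k (y, c) V ->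
  allrel (inc_rel k) U V -> allrel (inc_rel k) U (recolour c d V).
Proof.
move=> ck dk /belowP Ux /belowP Uy /aboveP Vx /aboveP Vy /allrel_inc UV.
apply/allrel_inc => p _ pU /mapP[q qV ->] /=.
rewrite /swapc; case: eqP => [qc|_].
  by move=> pd _; apply: (leq_trans (Uy _ pU pd dk)); apply: Vy.
case: eqP => [qd|_]; last exact: UV.
by move=> pc _; apply: (leq_trans (Ux _ pU pc ck)); apply: Vx.
Qed.

Lemma transfer_triple a b c a' b' c' :
  (forall U V k i j l, let W := U ++ [:: (a, i); (b, j); (c, l)] ++ V in colours k W ->
    exists i' j' l' V', let W' := U ++ [:: (a', i'); (b', j'); (c', l')] ++ V' in
    [/\ map fst V' = map fst V, colours k W' & ncol k W' = ncol k W]) ->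
  transfer [:: a; b; c] [:: a'; b'; c'].
Proof.
move=> h u v k W /map_fst_cat3[U [X [V [-> eu eX ev]]]].
case: X eX => [|[? i] [|[? j] [|[? l] [|]]]] //= [-> -> ->] /h[i' [j' [l' [V' [e' c'' n']]]]].
by exists (U ++ [:: (a', i'); (b', j'); (c', l')] ++ V'); split; rewrite // !map_cat /= eu e' ev.
Qed.

(* If [x] and [z] share a colour and [y] has another one, the two chains exchange
   their tails, which is possible because [x < y <= z]. *)
Lemma transfer_yxz x y z : x < y -> y <= z -> transfer [:: y; x; z] [:: y; z; x].
Proof.
move=> xy yz; apply: transfer_triple => U V k d c e /=.
rewrite colours_triple => /and4P[/and3P[cU cV UV] /and3P[Uy Ux Uz] /and3P[Vy Vx Vz] /and3P[yx yz' xz]].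
have [/andP[/eqP ec ck]|nec] := boolP ((c == e) && (c < k)); last first.
  exists d, e, c, V; split=> //; last by clear -k; rewrite !ncol_triple /=; lia.
  rewrite -[_ ++ _]/(U ++ [:: (y, d); (z, e); (x, c)] ++ V) colours_triple; apply/and4P; split; apply/and3P; split=> //.
  by rewrite /inc_rel /=; move: nec; rewrite eq_sym; case: eqP => //= ->; case: ltnP.
(* An uncoloured [y] takes over the colour of [x], and [x] becomes uncoloured. *)
subst e; have [kd|dk] := leqP k d.
  exists c, c, d, V; split=> //; last by clear -k; rewrite !ncol_triple /=; lia.
  rewrite colours_triple; apply/and4P; split; apply/and3P; split=> //.
  - exact: below_le (ltnW xy) Ux.
  - exact: below_uncoloured.
  - exact: above_le Vz.
  - exact: above_uncoloured.
  - by rewrite /inc_rel /= yz implybT.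
  - by rewrite /inc_rel /= (ltn_eqF (leq_trans ck kd)).
  - by rewrite /inc_rel /= (ltn_eqF (leq_trans ck kd)).
have dc : d != c by apply: contraL yx => /eqP ->; rewrite /inc_rel /= eqxx ck /= -ltnNge.
have sc : swapc c d c = d by rewrite /swapc eqxx.
have sd : swapc c d d = c by rewrite /swapc eqxx (negbTE dc).
exists d, d, c, (recolour c d V); split; first exact: fst_recolour.
  rewrite colours_triple; apply/and4P; split; apply/and3P; split=> //.
  - by rewrite colours_recolour.
  - by apply: (@allrel_recolour _ _ _ x y) => //; [exact: above_le (ltnW xy) Vy|exact: above_le Vz].
  - exact: below_le Uy.
  - by apply: above_recolour; rewrite ?sd //; exact: above_le Vz.
  - by apply: above_recolour; rewrite ?sd.
  - by apply: above_recolour; rewrite ?sc //; exact: above_le (ltnW xy) Vy.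
  - by rewrite /inc_rel /= yz implybT.
  - by rewrite /inc_rel /= (negbTE dc).
by rewrite !ncol_triple ncol_recolour //= ck dk.
Qed.

(** Every letter keeps its colour; the only new pair to check is [x] before [z], where [x < z]. The
    same argument serves for [transfer_zxy]. *)
Lemma transfer_yzx x y z : x < y -> y <= z -> transfer [:: y; z; x] [:: y; x; z].
Proof.
move=> xy yz; apply: transfer_triple => U V k d e c /=.
rewrite colours_triple => /and4P[/and3P[cU cV UV] /and3P[Uy Uz Ux] /and3P[Vy Vz Vx] /and3P[yz' yx zx]].
exists d, c, e, V; split=> //; last by clear -k; rewrite !ncol_triple /=; lia.
rewrite colours_triple; apply/and4P; split; apply/and3P; split=> //.
by rewrite /inc_rel /= (leq_trans (ltnW xy) yz) implybT.
Qed.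

Lemma transfer_zxy x y z : x <= y -> y < z -> transfer [:: z; x; y] [:: x; z; y].
Proof.
move=> xy yz; apply: transfer_triple => U V k e c d /=.
rewrite colours_triple => /and4P[/and3P[cU cV UV] /and3P[Uz Ux Uy] /and3P[Vz Vx Vy] /and3P[zx zy xy']].
exists c, e, d, V; split=> //; last by clear -k; rewrite !ncol_triple /=; lia.
rewrite colours_triple; apply/and4P; split; apply/and3P; split=> //.
by rewrite /inc_rel /= (leq_trans xy (ltnW yz)) implybT.
Qed.

(** Only a colour shared by [x] and [z] obstructs the move. Then [y] follows [x] in that colour and
    [z] receives the old colour of [y]; if that colour is below [k], the tails are exchanged, as
    [x <= y < z] allows. *)
Lemma transfer_xzy x y z : x <= y -> y < z -> transfer [:: x; z; y] [:: z; x; y].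
Proof.
move=> xy yz; apply: transfer_triple => U V k c e d /=.
rewrite colours_triple => /and4P[/and3P[cU cV UV] /and3P[Ux Uz Uy] /and3P[Vx Vz Vy] /and3P[xz xy' zy]].
have [/andP[/eqP ec ck]|nec] := boolP ((c == e) && (c < k)); last first.
  exists e, c, d, V; split=> //; last by clear -k; rewrite !ncol_triple /=; lia.
  rewrite colours_triple; apply/and4P; split; apply/and3P; split=> //.
  by rewrite /inc_rel /=; move: nec; rewrite eq_sym; case: eqP => //= ->; case: ltnP.
subst e; have [kd|dk] := leqP k d.
  exists d, c, c, V; split=> //; last by clear -k; rewrite !ncol_triple /=; lia.
  rewrite colours_triple; apply/and4P; split; apply/and3P; split=> //.
  - exact: below_uncoloured.
  - exact: below_le Ux.
  - exact: above_uncoloured.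
  - exact: above_le (ltnW yz) Vz.
  - by rewrite /inc_rel /= (gtn_eqF (leq_trans ck kd)).
  - by rewrite /inc_rel /= (gtn_eqF (leq_trans ck kd)).
  - by rewrite /inc_rel /= xy implybT.
have dc : d != c by apply: contraL zy => /eqP ->; rewrite /inc_rel /= eqxx ck /= -ltnNge.
have sc : swapc c d c = d by rewrite /swapc eqxx.
have sd : swapc c d d = c by rewrite /swapc eqxx (negbTE dc).
exists d, c, c, (recolour c d V); split; first exact: fst_recolour.
  rewrite colours_triple; apply/and4P; split; apply/and3P; split=> //.
  - by rewrite colours_recolour.
  - by apply: (@allrel_recolour _ _ _ x y) => //; [exact: above_le Vy|exact: above_le (ltnW yz) Vz].
  - exact: below_le (ltnW yz) Uy.
  - exact: below_le Ux.
  - by apply: above_recolour; rewrite ?sd.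
  - by apply: above_recolour; rewrite ?sc //; exact: above_le Vy.
  - by apply: above_recolour; rewrite ?sc.
  - by rewrite /inc_rel /= (negbTE dc).
  - by rewrite /inc_rel /= (negbTE dc).
  - by rewrite /inc_rel /= xy implybT.
by rewrite !ncol_triple ncol_recolour //= ck dk.
Qed.

(** * Row insertion *)

(** Not Knuth equivalence itself but the consequence used here: colourings pass in both
    directions. *)
Definition plactic w w' := transfer w w' /\ transfer w' w.

Lemma plactic_refl w : plactic w w.
Proof. by split; apply: transfer_refl. Qed.

Lemma plactic_trans w2 w1 w3 : plactic w1 w2 -> plactic w2 w3 -> plactic w1 w3.
Proof. by move=> [a b] [c d]; split; [apply: transfer_trans a c|apply: transfer_trans d b]. Qed.

Lemma plactic_ctx a b w w' : plactic w w' -> plactic (a ++ w ++ b) (a ++ w' ++ b).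
Proof. by case=> h1 h2; split; apply: transfer_ctx. Qed.

Lemma plactic_yzx x y z : x < y -> y <= z -> plactic [:: y; z; x] [:: y; x; z].
Proof. by move=> xy yz; split; [apply: transfer_yzx|apply: transfer_yxz]. Qed.

Lemma plactic_xzy x y z : x <= y -> y < z -> plactic [:: x; z; y] [:: z; x; y].
Proof. by move=> xy yz; split; [apply: transfer_xzy|apply: transfer_zxy]. Qed.

(** The letter [x] moves left through [r] one step at a time; each move uses the letter before the
    one passed, which is still larger than [x]. *)
Lemma plactic_shift_left y r x : path leq y r -> x < y -> plactic (y :: rcons r x) (y :: x :: r).
Proof.
move=> + xy; elim/last_ind: r => [|r z IHr]; first by move=> _; apply: plactic_refl.
rewrite rcons_path => /andP[yr lz].
have xl : x < last y r.
  have: all (leq y) r by apply: order_path_min yr; apply: leq_trans.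
  by case/lastP: r {IHr yr lz} => //= r u; rewrite all_rcons last_rcons => /andP[/(leq_trans xy)].
apply: (@plactic_trans (y :: rcons (rcons r x) z)).
  have := plactic_ctx (belast y r) [::] (plactic_yzx xl lz).
  rewrite !cats0 -!rcons_cons.
  by rewrite [y :: r]lastI -!cats1 -!catA.
by have := plactic_ctx [::] [:: z] (IHr yr); rewrite /= !cats1.
Qed.

(** The letter [y] moves left to the front; each move uses the smaller letter standing just after
    [y]. *)
Lemma plactic_shift_head r y x : sorted leq (rcons r x) -> x < y ->
  plactic (r ++ [:: y; x]) (y :: rcons r x).
Proof.
elim/last_ind: r x => [|r q IHr] x; first by move=> _ _; apply: plactic_refl.
move=> srx xy; have /andP[srq qx] : sorted leq (rcons r q) && (q <= x).
  by move: srx; case: r {IHr} => [|a r] /=; rewrite ?andbT // rcons_path last_rcons.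
apply: (@plactic_trans (r ++ [:: y; q; x])).
  have := plactic_ctx r [::] (plactic_xzy qx xy).
  by rewrite !cats0 cat_rcons.
have := plactic_ctx [::] [:: x] (IHr q srq (leq_ltn_trans qx xy)).
by rewrite /= -!catA /= cats1.
Qed.

(** If no letter exceeds [x], the index is [size r], where [set_nth] appends; one formula covers
    appending and bumping. *)
Definition rowins r x := set_nth 0 r (find (ltn x) r) x.

Lemma rsk_ins_cons r t x : rsk_ins (r :: t) x =
  rowins r x :: (if find (ltn x) r == size r then t else rsk_ins t (nth 0 r (find (ltn x) r))).
Proof.
rewrite /= -[find _ r]/(find (ltn x) r) /rowins; case: eqP => // ->.
by elim: r => //= a r [->].
Qed.

Lemma sorted_find_ge r x i : sorted leq r -> i < size r -> (x < nth 0 r i) = (find (ltn x) r <= i).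
Proof.
move=> sr ir; have [fi|] := leqP (find (ltn x) r) i; last exact: before_find.
have fs := leq_ltn_trans fi ir.
apply: leq_trans (_ : nth 0 r (find (ltn x) r) <= _).
  by apply: (@nth_find _ 0 (ltn x)); rewrite has_find.
exact: (sorted_leq_nth leq_trans leqnn 0 sr).
Qed.

Lemma size_rowins r x : size (rowins r x) = maxn (find (ltn x) r).+1 (size r).
Proof. exact: size_set_nth. Qed.

Lemma nth_rowins r x i : nth 0 (rowins r x) i = if i == find (ltn x) r then x else nth 0 r i.
Proof. by rewrite nth_set_nth. Qed.

Lemma sorted_rowins r x : sorted leq r -> sorted leq (rowins r x).
Proof.
move=> sr; apply/(sortedP 0) => i; rewrite size_rowins !nth_rowins => ir.
have fs := find_size (ltn x) r.
have [e1|n1] := eqVneq i; have [e2|n2] := eqVneq i.+1; first by lia.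
- have := @sorted_find_ge r x i.+1 sr; lia.
- have := @sorted_find_ge r x i sr; lia.
- by move/(sortedP 0): sr; apply; lia.
Qed.

(** First [x] moves left until it stands just after the bumped letter, then that letter moves to the
    front of the row. *)
Lemma plactic_bump r x : sorted leq r -> find (ltn x) r < size r ->
  plactic (rcons r x) (nth 0 r (find (ltn x) r) :: rowins r x).
Proof.
move=> sr fr; set i := find _ _ in fr *; set y := nth 0 r i.
have er : r = take i r ++ y :: drop i.+1 r by rewrite -drop_nth // cat_take_drop.
have xy : x < y by rewrite sorted_find_ge.
have erow : rowins r x = rcons (take i r) x ++ drop i.+1 r.
  by rewrite /rowins -/i set_nthE fr cat_rcons.
have srow := sorted_rowins x sr.
rewrite erow in srow *.
apply: (@plactic_trans (take i r ++ y :: x :: drop i.+1 r)).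
  rewrite {1}er rcons_cat -[X in plactic X]cats0 -[X in plactic _ X]cats0 -!catA.
  apply: plactic_ctx; apply: plactic_shift_left => //.
  by move: sr; rewrite {1}er => /cat_sorted2[_].
have /(plactic_ctx [::] (drop i.+1 r)) := plactic_shift_head (fst (cat_sorted2 srow)) xy.
by rewrite /= -catA.
Qed.

Fixpoint reading (t : seq (seq nat)) := if t is r :: t' then reading t' ++ r else [::].

Lemma plactic_ins t x : all (sorted leq) t -> plactic (rcons (reading t) x) (reading (rsk_ins t x)).
Proof.
elim: t x => [|r t IHt] x; first by move=> _; apply: plactic_refl.
move=> /andP[sr st]; rewrite rsk_ins_cons; case: eqP => [e|ne].
  rewrite /= rcons_cat /rowins e.
  suff -> : set_nth 0 r (size r) x = rcons r x by apply: plactic_refl.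
  by elim: r {sr e} => //= a r ->.
have fr : find (ltn x) r < size r by have := find_size (ltn x) r; lia.
have /(plactic_ctx (reading t) [::]) := plactic_bump sr fr; rewrite !cats0 /= rcons_cat => h.
apply: plactic_trans h _; rewrite -cat_rcons.
exact: (plactic_ctx [::] (rowins r x) (IHt _ st)).
Qed.

Definition rsk w := foldl rsk_ins [::] w.

(** * Tableaux and their preservation under insertion *)

Definition dominates (r s : seq nat) :=
  (size s <= size r) && all (fun j => nth 0 r j < nth 0 s j) (iota 0 (size s)).

Lemma dominatesP r s : reflect (size s <= size r /\ forall j, j < size s -> nth 0 r j < nth 0 s j) (dominates r s).
Proof.
apply: (iffP andP) => -[le h]; split=> //.
  by move=> j js; apply: (allP h); rewrite mem_iota.
by apply/allP => j; rewrite mem_iota => /h.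
Qed.

Lemma dominates_trans : transitive dominates.
Proof.
move=> s r u /dominatesP[sr h1] /dominatesP[us h2]; apply/dominatesP; split; first exact: leq_trans sr.
by move=> j ju; apply: ltn_trans (h2 j ju); apply: h1; apply: leq_trans us.
Qed.

Definition tableau t := all (sorted leq) t && sorted dominates t.

Lemma dominates_append r s x : dominates r s -> find (ltn x) r = size r -> dominates (rowins r x) s.
Proof.
move=> /dominatesP[sr h] e; apply/dominatesP; rewrite size_rowins e; split; first by lia.
by move=> j js; rewrite nth_rowins e; case: eqP; [lia|move=> _; apply: h].
Qed.

Lemma dominates_bump r s x : sorted leq r -> sorted leq s -> dominates r s -> find (ltn x) r < size r ->
  dominates (rowins r x) (rowins s (nth 0 r (find (ltn x) r))).
Proof.
move=> sr ss /dominatesP[ser h] fr; set i := find _ _ in fr *; set y := nth 0 r i.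
have xy : x < y by rewrite sorted_find_ge.
(* A bumped letter lands weakly to the left one row down, since the entry of [s] below [y], if
   present, exceeds [y]. *)
have fi : find (ltn y) s <= i.
  by have [le|si] := leqP (size s) i; [apply: leq_trans (find_size _ _) le|rewrite -sorted_find_ge // h].
have fs := find_size (ltn y) s.
apply/dominatesP; rewrite !size_rowins -/i; split=> [|j js]; first by lia.
rewrite !nth_rowins -/i; have [ej|nj] := eqVneq j (find (ltn y) s); case: eqVneq => [ei|ni] //.
- have := @sorted_find_ge r x j sr; rewrite -/i; lia.
- by apply: ltn_trans xy _; rewrite ei; apply: h; lia.
- by apply: h; lia.
Qed.

Lemma rsk_ins_head t x : exists t', rsk_ins t x = rowins (head [::] t) x :: t'.
Proof. by case: t => [|r t]; [exists [::]|rewrite rsk_ins_cons; eexists]. Qed.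

Lemma tableau_ins t x : tableau t -> tableau (rsk_ins t x).
Proof.
elim: t x => // r t IHt x /andP[/andP[sr st] dt].
have {}st : all (sorted leq) t := st.
have tt : tableau t by rewrite /tableau st (path_sorted dt).
have drs : dominates r (head [::] t) by move: dt; case: (t) => //= s t' /andP[].
have shead : sorted leq (head [::] t) by move: st; case: (t) => //= s t' /andP[].
rewrite rsk_ins_cons /tableau; case: eqP => [e|ne].
  rewrite /= sorted_rowins //= st /=; move: dt; case: (t) => //= s t' /andP[ds ->].
  by rewrite dominates_append.
have fr : find (ltn x) r < size r by have := find_size (ltn x) r; lia.
have /andP[st' dt'] := IHt (nth 0 r (find (ltn x) r)) tt.
rewrite /= sorted_rowins //= st' /=.
have [t' e] := rsk_ins_head t (nth 0 r (find (ltn x) r)).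
by move: dt'; rewrite e /= => ->; rewrite dominates_bump.
Qed.

Lemma rsk_rcons w x : rsk (rcons w x) = rsk_ins (rsk w) x.
Proof. by rewrite /rsk -cats1 foldl_cat. Qed.

Lemma tableau_rsk w : tableau (rsk w).
Proof. by elim/last_ind: w => // w x; rewrite rsk_rcons; apply: tableau_ins. Qed.

Lemma plactic_rsk w : plactic w (reading (rsk w)).
Proof.
elim/last_ind: w => [|w x IHw]; first exact: plactic_refl.
have /andP[st _] := tableau_rsk w.
rewrite rsk_rcons; apply: plactic_trans (plactic_ins x st).
by have := plactic_ctx [::] [:: x] IHw; rewrite /= !cats1.
Qed.

(** * Greene's inequalities *)

Definition word_shape w := map size (rsk w).
Definition psum k (la : seq nat) := \sum_(i < k) nth 0 la i.

(* A colour and a class share at most one letter. *)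
Lemma antichain_bound k q (Z : seq ((nat * nat) * nat)) : colours k (map fst Z) ->
  pairwise (fun a b => (a.2 == b.2) ==> (b.1.1 < a.1.1)) Z ->
  ncol k (map fst Z) <= k * q + count (fun a => q <= a.2) Z.
Proof.
rewrite /colours pairwise_map => cZ aZ; rewrite /ncol count_map.
pose P (a : (nat * nat) * nat) := a.1.2 < k; pose Q (a : (nat * nat) * nat) := a.2 < q.
rewrite -/(count P Z) -size_filter -(count_predC Q (filter P Z)) -!size_filter -!filter_predI.
apply: leq_add; last first.
  by rewrite !size_filter; apply: sub_count => a /= /andP[]; rewrite /Q -leqNgt.
have -> : k * q = size [seq (i, j) | i <- iota 0 k, j <- iota 0 q].
  by rewrite size_allpairs !size_iota.
rewrite size_filter -size_filter -(size_map (fun a => (a.1.2, a.2))).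
apply: uniq_leq_size.
  rewrite uniq_pairwise pairwise_map.
  have : pairwise [rel a b | inc_rel k a.1 b.1 && ((a.2 == b.2) ==> (b.1.1 < a.1.1))] [seq a <- Z | predI Q P a].
    by apply: subseq_pairwise (filter_subseq _ _) _; rewrite pairwise_relI cZ aZ.
  have fP : all P [seq a <- Z | predI Q P a].
    by apply/allP => a; rewrite mem_filter => /andP[/andP[]].
  apply: (sub_in_pairwise (P := P)) => // a b Pa _ /= /andP[h1 h2].
  apply/eqP => -[e1 e2]; move: h1 h2; rewrite /inc_rel e1 e2 !eqxx /=.
  by have /= {}Pa : a.1.2 < k := Pa; rewrite e1 in Pa; rewrite Pa /=; rewrite leqNgt => /negbTE ->.
move=> _ /mapP[a + ->]; rewrite mem_filter => /andP[/andP[Qa Pa] _].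
by apply/allpairsP; exists (a.1.2, a.2); rewrite !mem_iota.
Qed.

(** Each letter of the reading word is labelled by its column; in a tableau the columns are
    decreasing subsequences of that word. *)
Fixpoint col_reading (t : seq (seq nat)) : seq (nat * nat) :=
  if t is r :: t' then col_reading t' ++ zip r (iota 0 (size r)) else [::].

Lemma fst_col_reading t : map fst (col_reading t) = reading t.
Proof. by elim: t => //= r t IHt; rewrite map_cat IHt -/unzip1 unzip1_zip ?size_iota. Qed.

Lemma mem_col_reading t p : p \in col_reading t -> exists s, [/\ s \in t, p.2 < size s & p.1 = nth 0 s p.2].
Proof.
elim: t => //= r t IHt; rewrite mem_cat => /orP[/IHt[s [st h1 h2]]|].
  by exists s; rewrite inE st orbT.
move=> /(nthP (0, 0))[i]; rewrite size_zip size_iota minnn => ir <-.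
by rewrite nth_zip ?size_iota //= nth_iota //; exists r; rewrite mem_head.
Qed.

Lemma col_reading_antichain t : tableau t ->
  pairwise (fun p q : nat * nat => (p.2 == q.2) ==> (q.1 < p.1)) (col_reading t).
Proof.
move=> /andP[_]; rewrite (sorted_pairwise dominates_trans).
elim: t => //= r t IHt /andP[/allP dr /IHt{}IHt]; rewrite pairwise_cat IHt andTb; apply/andP; split.
  apply/allrelP => p q /mem_col_reading[s [st ps ->]] qr; apply/implyP => /eqP e.
  have [_ [/[1!inE]/eqP-> _ ->]] : exists s, [/\ s \in [:: r], q.2 < size s & q.1 = nth 0 s q.2].
    exact: mem_col_reading.
  by rewrite -e; have /dominatesP[_] := dr _ st; apply.
have: pairwise [rel x y | x != y] (map snd (zip r (iota 0 (size r)))).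
  by rewrite -uniq_pairwise -/unzip2 unzip2_zip ?size_iota ?iota_uniq.
by rewrite pairwise_map; apply: sub_pairwise => p q /= /negbTE ->.
Qed.

Lemma count_col_reading q t : count (fun p => q <= p.2) (col_reading t) = sumn [seq size r - q | r <- t].
Proof.
elim: t => //= r t IHt; rewrite count_cat IHt addnC; congr (_ + _).
have -> : count (fun p => q <= p.2) (zip r (iota 0 (size r))) = count (leq q) (iota 0 (size r)).
  by rewrite -[in RHS](@unzip2_zip _ _ r (iota 0 (size r))) ?size_iota // count_map.
elim: (size r) => // n IHn; rewrite -addn1 iotaD count_cat IHn /= add0n; clear; lia.
Qed.

(** With [q] the [k]-th row length, each of the first [k] rows contributes [q] plus its excess over
    [q], and later rows have no excess. For this [q] the column bound does not exceed the sum of the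
    first [k] rows. *)
Lemma psum_bound k la : sorted geq la -> 0 < k ->
  k * nth 0 la k.-1 + sumn [seq n - nth 0 la k.-1 | n <- la] <= psum k la.
Proof.
rewrite /psum; elim: la k => [|n la IHla] [//|k] sla _; first by rewrite nth_nil muln0.
rewrite big_ord_recl /=; case: k => [|k] /=.
  rewrite big_ord0 subnn; have /allP nla := order_path_min (rev_trans leq_trans) sla.
  have /all_pred1P -> : all (pred1 0) [seq m - n | m <- la].
    by apply/allP => _ /mapP[m /nla /= mn ->]; rewrite subn_eq0.
  by rewrite sumn_nseq mul1n !addn0.
have := IHla k.+1 (path_sorted sla) isT; rewrite /= => h.
have nq : nth 0 la k <= n.
  have [ks|] := ltnP k (size la); last by move=> ?; rewrite nth_default.
  by have /allP := order_path_min (rev_trans leq_trans) sla; apply; apply: mem_nth.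
apply: leq_trans (leq_add (leqnn n) h); rewrite (mulSn k.+1).
by move: nq; clear; lia.
Qed.

Lemma sorted_sizes t : tableau t -> sorted geq (map size t).
Proof. by move=> /andP[_]; rewrite sorted_map; apply: sub_sorted => r s /dominatesP[]. Qed.

Lemma ncol_antichains k q (W L : seq (nat * nat)) : map fst W = map fst L -> colours k W ->
  pairwise (fun a b : nat * nat => (a.2 == b.2) ==> (b.1 < a.1)) L ->
  ncol k W <= k * q + count (fun a => q <= a.2) L.
Proof.
move=> eWL cW aL; set Z := zip W (map snd L).
have sZ : size W = size L by rewrite -(size_map fst W) eWL size_map.
have fZ : map fst Z = W by rewrite -/unzip1 unzip1_zip // size_map sZ.
have eZ : [seq (a.1.1, a.2) | a <- Z] = L.
  rewrite /Z; move: sZ eWL; clear; elim: L W => [|[x c] L IHL] [|[y d] W] //=.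
  by move=> [/IHL{}IHL] [-> /IHL ->].
have := @antichain_bound k q Z; rewrite fZ -[in count _ L]eZ count_map; apply=> //.
by rewrite -eZ pairwise_map in aL.
Qed.

(** The colouring is transferred to the reading word of the tableau, where the columns limit the
    number of coloured letters. *)
Lemma greene_lower k W : colours k W -> ncol k W <= psum k (word_shape (map fst W)).
Proof.
move=> cW; have [|W' [eW' cW' <-]] := (plactic_rsk (map fst W)).1 [::] [::] k W _ cW.
  by rewrite /= cats0.
have tt := tableau_rsk (map fst W).
rewrite /word_shape; move: {cW W} (rsk (map fst W)) eW' tt => t; rewrite /= cats0 => eW' tt.
case: k cW' => [|k] cW'; first by rewrite /ncol (eq_count (a2 := pred0)) ?count_pred0.
apply: leq_trans (psum_bound (sorted_sizes tt) _) => //.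
rewrite -map_comp -count_col_reading; apply: ncol_antichains => //.
  by rewrite fst_col_reading.
exact: col_reading_antichain.
Qed.

(** With row indices as colours, starting from 0, the first [k] rows become [k] increasing
    chains. *)
Fixpoint row_reading i (t : seq (seq nat)) : seq (nat * nat) :=
  if t is r :: t' then row_reading i.+1 t' ++ [seq (x, i) | x <- r] else [::].

Lemma fst_row_reading i t : map fst (row_reading i t) = reading t.
Proof. by elim: t i => //= r t IHt i; rewrite map_cat IHt -map_comp map_id. Qed.

Lemma row_reading_ge i t p : p \in row_reading i t -> i <= p.2.
Proof.
elim: t i => //= r t IHt i; rewrite mem_cat => /orP[/IHt /ltnW //|/mapP[x _ ->]].
exact: leqnn.
Qed.

Lemma colours_row_reading k i t : all (sorted leq) t -> colours k (row_reading i t).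
Proof.
rewrite /colours; elim: t i => //= r t IHt i /andP[sr st].
rewrite pairwise_cat IHt // andTb; apply/andP; split.
  apply/allrel_inc => p _ /row_reading_ge ip /mapP[x _ ->] /= e.
  by rewrite e ltnn in ip.
rewrite pairwise_map; move: sr; rewrite (sorted_pairwise leq_trans).
by apply: sub_pairwise => x y /= xy; rewrite /inc_rel /= xy implybT.
Qed.

Lemma ncol_row_reading k i t : ncol k (row_reading i t) = psum (k - i) (map size t).
Proof.
rewrite /psum; elim: t i => [|r t IHt] i /=.
  by rewrite big1 // => j _; rewrite nth_nil.
rewrite ncol_cat IHt /ncol count_map.
have [ki|ik] := leqP k i.
  rewrite (eq_count (a2 := pred0)) => [|x /=]; last by rewrite ltnNge ki.
  have [-> ->] : k - i = 0 /\ k - i.+1 = 0 by move: ki; clear; lia.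
  by rewrite count_pred0 !big_ord0.
rewrite (eq_count (a2 := predT)) => [|x /=]; last by rewrite ik.
have -> : k - i = (k - i.+1).+1 by move: ik; clear; lia.
by rewrite count_predT big_ord_recl addnC.
Qed.

(** The colouring of the tableau by its first [k] rows is carried back to the word itself, where the
    given decreasing classes bound it. *)
Lemma greene_upper k q (L : seq (nat * nat)) :
  pairwise (fun a b : nat * nat => (a.2 == b.2) ==> (b.1 < a.1)) L ->
  psum k (word_shape (map fst L)) <= k * q + count (fun a => q <= a.2) L.
Proof.
move=> aL; have /andP[st _] := tableau_rsk (map fst L).
have [|W [eW cW]] := (plactic_rsk (map fst L)).2 [::] [::] k _ _ (colours_row_reading k 0 st).
  by rewrite fst_row_reading /= cats0.
rewrite ncol_row_reading subn0 -/(word_shape _) => <-; rewrite /= cats0 in eW.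
exact: ncol_antichains.
Qed.

(** * The diamond *)

(* Row [b] occupies the columns from [mid_dist M b] to [2 M + 1 - mid_dist M b];
   the middle row is [M] and the central points are [(M, M)] and [(M + 1, M)]. *)
Definition mid_dist M b := (b - M) + (M - b).

Definition diamond M : seq (nat * nat) :=
  [seq (mid_dist M b + s, b) | b <- iota 0 M.*2.+1, s <- iota 0 (M.+1 - mid_dist M b).*2].

Lemma mem_diamond M a b :
  ((a, b) \in diamond M) = (mid_dist M b <= a) && (a + mid_dist M b < M.+1.*2).
Proof.
apply/allpairsPdep/andP => [[b' [s [_]]]|[h1 h2]].
  by rewrite mem_iota => /andP[_ h] [-> ->]; move: h; clear; lia.
exists b, (a - mid_dist M b); rewrite !mem_iota /=; split.
- by move: h1 h2; rewrite /mid_dist; clear; lia.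
- by move: h1 h2; clear; lia.
- by rewrite subnKC.
Qed.

Lemma uniq_diamond M : uniq (diamond M).
Proof.
apply: allpairs_uniq_dep => [|b _|]; try exact: iota_uniq.
by move=> [b s] [b' s'] _ _ /= [+ e]; rewrite -e => /addnI ->.
Qed.

Lemma sum_odds_up M : \sum_(0 <= b < M) (M.+1 - mid_dist M b).*2 = M * M.+1.
Proof.
rewrite (eq_big_nat _ _ (F2 := fun b => b.+1.*2)) => [|b /andP[_ bM]].
  elim: M => [|M IHM]; first by rewrite big_geq.
  by rewrite big_nat_recr //= IHM; clear; lia.
by rewrite /mid_dist; lia.
Qed.

Lemma sum_odds_down M : \sum_(0 <= b < M.+1) (M.+1 - mid_dist M (M + b)).*2 = M.+1 * M.+2.
Proof.
rewrite (eq_big_nat _ _ (F2 := fun b => (M.+1 - b).*2)) => [|b _]; last by rewrite /mid_dist; lia.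
rewrite big_nat_rev /= (eq_big_nat _ _ (F2 := fun b => b.+1.*2)) => [|b /andP[_ bM]]; last by lia.
elim: M.+1 => [|n IHn]; first by rewrite big_geq.
by rewrite big_nat_recr //= IHn; clear; lia.
Qed.

Lemma size_diamond M : size (diamond M) = 2 * (M.+1 * M.+1).
Proof.
rewrite size_allpairs_dep sumnE big_map.
under eq_bigr do rewrite size_iota.
rewrite -[M.*2.+1]subn0 -/(index_iota _ _) (big_cat_nat (n := M)) //=; last by lia.
have -> : \sum_(M <= b < M.*2.+1) (M.+1 - mid_dist M b).*2 =
    \sum_(0 <= b < M.+1) (M.+1 - mid_dist M (M + b)).*2.
  rewrite -{1}[M]add0n big_addn; have -> : M.*2.+1 - M = M.+1 by lia.
  by apply: eq_bigr => b _; rewrite addnC.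
by rewrite sum_odds_up sum_odds_down; clear; lia.
Qed.

(** The second coordinate points upwards: positions read each column from the top, while values
    start with the bottom row. *)
Definition pos_lt (p q : nat * nat) := (p.1 < q.1) || (p.1 == q.1) && (q.2 < p.2).
Definition val_lt (p q : nat * nat) := (p.2 < q.2) || (p.2 == q.2) && (p.1 < q.1).

Lemma sort_pairwise (T : eqType) (lt : rel T) s : transitive lt ->
  (forall x y, [|| lt x y, x == y | lt y x]) -> uniq s ->
  pairwise lt (sort (fun x y => lt x y || (x == y)) s).
Proof.
move=> tr tot us; set le := fun x y => _.
have le_tr : transitive le.
  move=> y x z /orP[xy|/eqP->//] /orP[yz|/eqP<-]; rewrite /le ?xy //.
  by rewrite (tr _ _ _ xy yz).
have le_tot : total le by move=> x y; case/or3P: (tot x y) => h; rewrite /le h ?orbT.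
have: pairwise [rel x y | le x y && (x != y)] (sort le s).
  by rewrite pairwise_relI -(sorted_pairwise le_tr) sort_sorted // -uniq_pairwise sort_uniq.
by apply: sub_pairwise => x y /= /andP[/orP[//|->]].
Qed.

Lemma pos_lt_trans : transitive pos_lt.
Proof. by move=> [a b] [a' b'] [a'' b'']; rewrite /pos_lt /=; lia. Qed.

Lemma pos_lt_total p q : [|| pos_lt p q, p == q | pos_lt q p].
Proof. by case: p q => [a b] [a' b']; rewrite /pos_lt xpair_eqE /=; lia. Qed.

Lemma val_lt_trans : transitive val_lt.
Proof. by move=> [a b] [a' b'] [a'' b'']; rewrite /val_lt /=; lia. Qed.

Lemma val_lt_total p q : [|| val_lt p q, p == q | val_lt q p].
Proof. by case: p q => [a b] [a' b']; rewrite /val_lt xpair_eqE /=; lia. Qed.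

Definition by_pos M := sort (fun p q => pos_lt p q || (p == q)) (diamond M).
Definition by_val M := sort (fun p q => val_lt p q || (p == q)) (diamond M).
Definition rank M p := index p (by_val M).

Lemma mem_by_val M : by_val M =i diamond M.
Proof. by move=> p; rewrite mem_sort. Qed.

Lemma sub_pairwise_in (T : eqType) (r r' : rel T) s :
  {in s &, subrel r r'} -> pairwise r s -> pairwise r' s.
Proof.
by move=> rr'; apply: (sub_in_pairwise (P := [in s])) => //; apply/allP.
Qed.

Lemma rank_lt M p q : p \in diamond M -> q \in diamond M -> val_lt p q -> rank M p < rank M q.
Proof.
rewrite -!mem_by_val => pM qM pq; rewrite ltnNge; apply/negP => qp.
have irr x : val_lt x x = false by case: x => a b; rewrite /val_lt /= !ltnn eqxx.
have srt : sorted val_lt (by_val M).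
  by rewrite (sorted_pairwise val_lt_trans) sort_pairwise ?uniq_diamond //;
    [exact: val_lt_trans|exact: val_lt_total].
move: qp; rewrite leq_eqVlt => /orP[/eqP e|qp].
  by move: pq; rewrite -(nth_index p qM) [index q _]e nth_index // irr.
have := sorted_ltn_index val_lt_trans srt _ _ qM pM qp => h.
by have := val_lt_trans pq h; rewrite irr.
Qed.

(** * Greene's inequalities for labellings of the diamond, and class sizes *)

Lemma psum_chains M g col k :
  (forall p q, p \in diamond M -> q \in diamond M -> pos_lt p q ->
     col p = col q -> col p < k -> g p <= g q) ->
  count (fun p => col p < k) (diamond M) <= psum k (word_shape [seq g p | p <- by_pos M]).
Proof.
move=> h; have := @greene_lower k [seq (g p, col p) | p <- by_pos M].
rewrite -map_comp /ncol count_map /colours pairwise_map.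
have /seq.permP <- : perm_eq (by_pos M) (diamond M) by rewrite perm_sort.
apply; apply: sub_pairwise_in (sort_pairwise pos_lt_trans pos_lt_total (uniq_diamond M)).
by move=> p q; rewrite !mem_sort => pM qM pq; apply/implyP => /andP[/eqP e l]; apply: h.
Qed.

Lemma psum_antichains M g cl k q :
  (forall p r, p \in diamond M -> r \in diamond M -> pos_lt p r -> cl p = cl r -> g r < g p) ->
  psum k (word_shape [seq g p | p <- by_pos M]) <= k * q + count (fun p => q <= cl p) (diamond M).
Proof.
move=> h; have := @greene_upper k q [seq (g p, cl p) | p <- by_pos M].
rewrite -map_comp count_map pairwise_map.
have /seq.permP <- : perm_eq (by_pos M) (diamond M) by rewrite perm_sort.
apply; apply: sub_pairwise_in (sort_pairwise pos_lt_trans pos_lt_total (uniq_diamond M)).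
by move=> p r; rewrite !mem_sort => pM rM pr; apply/implyP => /eqP; apply: h.
Qed.

Lemma count_class_ge M (cl : nat * nat -> nat) j s (f : nat -> nat * nat) :
  (forall i, i < s -> f i \in diamond M) -> (forall i, i < s -> cl (f i) = j) ->
  (forall i i', f i = f i' -> i = i') ->
  s <= count (fun p => cl p == j) (diamond M).
Proof.
move=> fM fcl finj; rewrite -size_filter -{1}(size_iota 0 s) -(size_map f).
apply: uniq_leq_size; first by rewrite map_inj_uniq ?iota_uniq.
by move=> _ /mapP[i + ->]; rewrite mem_iota /= => ltis; rewrite mem_filter fM // fcl ?eqxx.
Qed.

Lemma count_ltS (T : Type) (cl : T -> nat) k s :
  count (fun p => cl p < k.+1) s = count (fun p => cl p < k) s + count (fun p => cl p == k) s.
Proof.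
elim: s => //= p s ->; rewrite ltnS leq_eqVlt; case: eqP => [->|_]; rewrite ?ltnn.
  by rewrite !addSn !addnS.
by rewrite addnA.
Qed.

Lemma count_ge_compl M (cl : nat * nat -> nat) q :
  count (fun p => cl p < q) (diamond M) + count (fun p => q <= cl p) (diamond M) = 2 * (M.+1 * M.+1).
Proof.
rewrite -size_diamond -(count_predC (fun p => cl p < q)); congr (_ + _).
by apply: eq_count => p /=; rewrite leqNgt.
Qed.

(** Adds [2(M+1)] and two classes of [2(M-t)] points for each [t < s]; the negative term [2s(s+1)]
    stands on the right to avoid truncated subtraction. *)
Lemma count_even_classes M (cl : nat * nat -> nat) s :
  2 * M.+1 <= count (fun p => cl p == 0) (diamond M) ->
  (forall t, t < M -> 2 * (M - t) <= count (fun p => cl p == t.*2.+1) (diamond M)) ->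
  (forall t, t < M -> 2 * (M - t) <= count (fun p => cl p == t.*2.+2) (diamond M)) ->
  s <= M ->
  2 * M.+1 + 4 * (M.+1 * s) <= count (fun p => cl p < s.*2.+1) (diamond M) + 2 * (s * s.+1).
Proof.
move=> h0 h1 h2; elim: s => [|s IHs] sM; first by rewrite (count_ltS cl 0); move: h0; clear; lia.
rewrite doubleS (count_ltS _ s.*2.+2) (count_ltS _ s.*2.+1).
by move: sM (IHs (ltnW sM)) (h1 s sM) (h2 s sM); clear; nia.
Qed.

(** Two classes of [2(M-t)+1] points for each [t < s] add up to [4s(M+1) - 2s^2]. *)
Lemma count_odd_classes M (cl : nat * nat -> nat) s :
  (forall t, t <= M -> (M - t).*2.+1 <= count (fun p => cl p == t.*2) (diamond M)) ->
  (forall t, t <= M -> (M - t).*2.+1 <= count (fun p => cl p == t.*2.+1) (diamond M)) ->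
  s <= M.+1 ->
  4 * (s * M.+1) <= count (fun p => cl p < s.*2) (diamond M) + 2 * (s * s).
Proof.
move=> h0 h1; elim: s => [|s IHs] sM; first by [].
rewrite doubleS !count_ltS.
by move: sM (IHs (ltnW sM)) (h0 s sM) (h1 s sM); clear; nia.
Qed.

(* A bent column is the upper part of column [c - 1] followed by the lower part of
   column [c]; a bent row moves up by one between columns [M] and [M + 1]. The class
   functions number rows, columns and their bent variants from the middle outwards,
   so that the longest come first. *)
Definition on_right M (p : nat * nat) : nat := M < p.1.
Definition upper M (p : nat * nat) := M + on_right M p <= p.2.
Definition column M (p : nat * nat) := p.1 + upper M p.

Definition row_class M (p : nat * nat) := if M <= p.2 then (p.2 - M).*2 else (M - p.2).*2.-1.
Definition column_class M (p : nat * nat) := if p.1 <= M then (M - p.1).*2 else (p.1 - M).*2.-1.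
Definition bent_column_class M (p : nat * nat) :=
  if M < column M p then (column M p - M.+1).*2 else (M.+1 - column M p).*2.-1.
Definition bent_row_class M (p : nat * nat) :=
  if upper M p then (p.2 - on_right M p - M).*2 else (M + on_right M p - p.2).*2.-1.

Ltac geometry := rewrite ?mem_diamond /row_class /column_class /bent_column_class /bent_row_class
  /column /upper /on_right /mid_dist /=; do ?case: ifP; lia.

Lemma count_row_class M s : s <= M ->
  2 * M.+1 + 4 * (M.+1 * s) <=
  count (fun p => row_class M p < s.*2.+1) (diamond M) + 2 * (s * s.+1).
Proof.
apply: count_even_classes => [|t tM|t tM].
- by apply: (@count_class_ge _ _ _ _ (fun s => (s, M))) => [i iM|i iM|i i' []] //; geometry.
- by apply: (@count_class_ge _ _ _ _ (fun s => (t.+1 + s, M - t.+1))) => [i iM|i iM|i i' []]; geometry.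
- by apply: (@count_class_ge _ _ _ _ (fun s => (t.+1 + s, M + t.+1))) => [i iM|i iM|i i' []]; geometry.
Qed.

Lemma count_bent_column_class M s : s <= M ->
  2 * M.+1 + 4 * (M.+1 * s) <=
  count (fun p => bent_column_class M p < s.*2.+1) (diamond M) + 2 * (s * s.+1).
Proof.
apply: count_even_classes => [|t tM|t tM].
(* The longest bent column climbs column [M + 1] up to [(M+1, M)] and then column [M] from [(M, M)];
   the shift [s.-1] reflects that row [M] is visited twice. *)
- apply: (@count_class_ge _ _ _ _ (fun s => if s <= M then (M.+1, s) else (M, s.-1))) => [i iM|i iM|i i'].
  + by case: leqP => ?; geometry.
  + by case: leqP => ?; geometry.
  + by case: leqP => ?; case: leqP => ? []; lia.
(* The row is [t + s]; below the middle row the points lie in column [M - t], from the middle row on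
   in column [M - t - 1]. *)
- apply: (@count_class_ge _ _ _ _ (fun s => (M - t.+1 + (t + s < M), t + s))) => [i iM|i iM|i i' []].
  + by geometry.
  + by geometry.
  + by lia.
- apply: (@count_class_ge _ _ _ _ (fun s => (M + t.+1 + (t.+1 + s <= M), t.+1 + s))) => [i iM|i iM|i i' []].
  + by geometry.
  + by geometry.
  + by lia.
Qed.

Lemma count_column_class M s : s <= M.+1 ->
  4 * (s * M.+1) <= count (fun p => column_class M p < s.*2) (diamond M) + 2 * (s * s).
Proof.
apply: count_odd_classes => t tM.
- by apply: (@count_class_ge _ _ _ _ (fun s => (M - t, t + s))) => [i iM|i iM|i i' []]; geometry.
- by apply: (@count_class_ge _ _ _ _ (fun s => (M + t.+1, t + s))) => [i iM|i iM|i i' []]; geometry.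
Qed.

Lemma count_bent_row_class M s : s <= M.+1 ->
  4 * (s * M.+1) <= count (fun p => bent_row_class M p < s.*2) (diamond M) + 2 * (s * s).
Proof.
apply: count_odd_classes => t tM.
- apply: (@count_class_ge _ _ _ _ (fun s => (t + s, M + t + (M < t + s)))) => [i iM|i iM|i i' []].
  + by geometry.
  + by geometry.
  + by lia.
- apply: (@count_class_ge _ _ _ _ (fun s => (t.+1 + s, M + (M < t.+1 + s) - t.+1))) => [i iM|i iM|i i' []].
  + by geometry.
  + by geometry.
  + by lia.
Qed.

(** * Exchanging the central values *)

Definition mid_swap M (p : nat * nat) :=
  if p == (M, M) then (M.+1, M) else if p == (M.+1, M) then (M, M) else p.

Lemma mid_swap_diamond M p : p \in diamond M -> mid_swap M p \in diamond M.
Proof.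
by rewrite /mid_swap => pM; case: eqP => _; [|case: eqP => _ //]; rewrite mem_diamond /mid_dist; lia.
Qed.

Definition word_pi M := [seq rank M p | p <- by_pos M].
Definition word_tau M := [seq rank M (mid_swap M p) | p <- by_pos M].

Lemma row_class_inc M p q : pos_lt p q -> row_class M p = row_class M q -> val_lt p q.
Proof. by case: p q => [a b] [a' b']; rewrite /pos_lt /val_lt; geometry. Qed.

Lemma column_class_dec M p q : pos_lt p q -> column_class M p = column_class M q -> val_lt q p.
Proof. by case: p q => [a b] [a' b']; rewrite /pos_lt /val_lt; geometry. Qed.

Lemma mid_swapE M p : mid_swap M p =
  (p.1 + (p == (M, M)) - (p == (M.+1, M)), p.2).
Proof.
by rewrite /mid_swap; case: eqP => [->|_]; [|case: eqP => [->|_]]; rewrite /= ?xpair_eqE ?eqxx;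
  case: p => * /=; congr (_, _); lia.
Qed.

Lemma bent_column_classE M p q : bent_column_class M p = bent_column_class M q ->
  column M p = column M q.
Proof. by rewrite /bent_column_class; case: ltnP => hp; case: ltnP => hq; clear -hp hq; lia. Qed.

Lemma bent_row_classE M p q : bent_row_class M p = bent_row_class M q ->
  upper M p = upper M q /\ p.2 + on_right M q = q.2 + on_right M p.
Proof. by rewrite /bent_row_class /upper; case: leqP => hp; case: leqP => hq; clear -hp hq; lia. Qed.

(** Along a bent column the row drops from each point to the next, except between the two central
    points, both in the longest one; the exchange puts just these two in decreasing order. *)
Lemma bent_column_class_dec M p q : pos_lt p q ->
  bent_column_class M p = bent_column_class M q -> val_lt (mid_swap M q) (mid_swap M p).
Proof.
move=> + /bent_column_classE; case: p q => [a b] [a' b'].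
rewrite !mid_swapE !xpair_eqE /pos_lt /val_lt /column /upper /on_right /=.
have [ha|ha] := ltnP M a; have [hb|hb] := ltnP M a'; clear -ha hb; lia.
Qed.

(** The central points lie in different bent rows, and each exchanged value still lies between those
    of its neighbours. *)
Lemma bent_row_class_inc M p q : pos_lt p q ->
  bent_row_class M p = bent_row_class M q -> val_lt (mid_swap M p) (mid_swap M q).
Proof.
move=> + /bent_row_classE[]; case: p q => [a b] [a' b'].
rewrite !mid_swapE !xpair_eqE /pos_lt /val_lt /upper /on_right /=.
have [ha|ha] := ltnP M a; have [hb|hb] := ltnP M a'; clear -ha hb; lia.
Qed.

(** Here [2r+1] rows face [2(M-r)+1] bent columns. With [M = r + s] the lower bound is
    [2r^2+4rs+4r+2s+2], exactly one more than the upper bound, whence the strict inequality. *)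
Lemma psum_odd M r : r <= M ->
  psum r.*2.+1 (word_shape (word_tau M)) < psum r.*2.+1 (word_shape (word_pi M)).
Proof.
move=> rM.
have hpi : count (fun p => row_class M p < r.*2.+1) (diamond M) <= psum r.*2.+1 (word_shape (word_pi M)).
  apply: psum_chains => p q pM qM pq e _.
  by apply/ltnW/rank_lt => //; apply: row_class_inc e.
have htau : psum r.*2.+1 (word_shape (word_tau M)) <= r.*2.+1 * (M - r).*2.+1 +
    count (fun p => (M - r).*2.+1 <= bent_column_class M p) (diamond M).
  apply: psum_antichains => p q pM qM pq e.
  by apply: rank_lt; rewrite ?mid_swap_diamond //; apply: bent_column_class_dec e.
move: hpi htau (count_row_class rM) (count_bent_column_class (leq_subr r M)).
move: (count_ge_compl M (bent_column_class M) (M - r).*2.+1).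
have [s eM] : exists s, M = r + s by exists (M - r); rewrite subnKC.
rewrite eM addKn; clear; lia.
Qed.

(** Now [2r] bent rows face [2(M+1-r)] columns; with [M + 1 = r + s] both bounds equal
    [2r^2+4rs]. *)
Lemma psum_even M r : r <= M.+1 ->
  psum r.*2 (word_shape (word_pi M)) <= psum r.*2 (word_shape (word_tau M)).
Proof.
move=> rM.
have htau : count (fun p => bent_row_class M p < r.*2) (diamond M) <= psum r.*2 (word_shape (word_tau M)).
  apply: psum_chains => p q pM qM pq e _.
  by apply/ltnW/rank_lt; rewrite ?mid_swap_diamond //; apply: bent_row_class_inc e.
have hpi : psum r.*2 (word_shape (word_pi M)) <= r.*2 * (M.+1 - r).*2 +
    count (fun p => (M.+1 - r).*2 <= column_class M p) (diamond M).
  apply: psum_antichains => p q pM qM pq e.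
  by apply: rank_lt => //; apply: column_class_dec e.
move: hpi htau (count_bent_row_class rM) (count_column_class (leq_subr r M.+1)).
move: (count_ge_compl M (column_class M) (M.+1 - r).*2).
have [s eM] : exists s, M.+1 = r + s by exists (M.+1 - r); rewrite subnKC.
rewrite eM addKn; clear; lia.
Qed.

Lemma psumS k la : psum k.+1 la = psum k la + nth 0 la k.
Proof. by rewrite /psum big_ord_recr. Qed.

(** Subtracting consecutive partial sums gives [la_j > mu_j] for even [j] and [la_j < mu_j] for odd
    [j], counting from 0, so each of the first [2(M+1)] rows contributes at least one. *)
Lemma sum_natdist_ge M la mu :
  (forall r, r <= M -> psum r.*2.+1 mu < psum r.*2.+1 la) ->
  (forall r, r <= M.+1 -> psum r.*2 la <= psum r.*2 mu) ->
  M.+1.*2 <= \sum_(j < M.+1.*2) natdist (nth 0 la j) (nth 0 mu j).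
Proof.
move=> hodd heven; rewrite -[X in X <= _]muln1 -[X in X * _]card_ord -sum_nat_const.
apply: leq_sum => -[j jM] _ /=; rewrite /natdist.
have [eo|ee] := boolP (odd j).
  have [r ej] : exists r, j = r.*2.+1 by exists j./2; rewrite -[LHS]odd_double_half eo.
  rewrite {}ej in jM *; have rM : r <= M by move: jM; clear; lia.
  move: (hodd r rM) (heven r.+1 rM); rewrite doubleS !(psumS r.*2.+1); clear; lia.
have [r ej] : exists r, j = r.*2 by exists j./2; rewrite -[LHS]odd_double_half (negbTE ee).
rewrite {}ej in jM *; have rM : r <= M by move: jM; clear; lia.
move: (hodd r rM) (heven r (leqW rM)); rewrite !(psumS r.*2); clear; lia.
Qed.

Lemma word_pi_perm M : perm_eq (word_pi M) (iota 0 (2 * (M.+1 * M.+1))).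
Proof.
have eqs : perm_eq (by_pos M) (by_val M) by rewrite perm_sort perm_sym perm_sort.
apply: perm_trans (perm_map (rank M) eqs) _.
have us : uniq (by_val M) by rewrite sort_uniq uniq_diamond.
rewrite -size_diamond -(size_sort (fun p q => val_lt p q || (p == q))) -/(by_val M).
suff -> : [seq rank M p | p <- by_val M] = iota 0 (size (by_val M)) by [].
apply: (@eq_from_nth _ 0); rewrite ?size_map ?size_iota // => i si.
by rewrite (nth_map (0, 0)) // nth_iota // /rank index_uniq.
Qed.

Definition swap_adj k x := if x == k then k.+1 else if x == k.+1 then k else x.

Lemma mid_low_in M : (M, M) \in diamond M.
Proof. by rewrite mem_diamond /mid_dist; lia. Qed.

Lemma mid_high_in M : (M.+1, M) \in diamond M.
Proof. by rewrite mem_diamond /mid_dist; lia. Qed.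

Lemma rank_size M p : p \in diamond M -> rank M p < 2 * (M.+1 * M.+1).
Proof. by rewrite -size_diamond -mem_by_val -index_mem size_sort. Qed.

Lemma rank_mid M : rank M (M.+1, M) = (rank M (M, M)).+1.
Proof.
have lt : rank M (M, M) < rank M (M.+1, M).
  by apply: rank_lt; rewrite ?mid_low_in ?mid_high_in // /val_lt /= eqxx ltnn ltnSn orbT.
apply/eqP; rewrite eqn_leq lt andbT leqNgt; apply/negP => lt2.
have s2 : (rank M (M, M)).+1 < size (by_val M).
  by apply: ltn_trans lt2 _; rewrite index_mem mem_by_val mid_high_in.
set p := nth (0, 0) (by_val M) (rank M (M, M)).+1.
have pM : p \in diamond M by rewrite -mem_by_val mem_nth.
have rp : rank M p = (rank M (M, M)).+1 by rewrite /rank index_uniq // sort_uniq uniq_diamond.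
have between : val_lt (M, M) p && val_lt p (M.+1, M).
  apply/andP; split; apply/negPn/negP => np.
    case/or3P: (val_lt_total (M, M) p) => [h|/eqP e|h]; first by rewrite h in np.
      by move: rp; rewrite -e; lia.
    by have := rank_lt pM (mid_low_in M) h; rewrite rp; lia.
  case/or3P: (val_lt_total p (M.+1, M)) => [h|/eqP e|h]; first by rewrite h in np.
    by move: rp; rewrite e; lia.
  by have := rank_lt (mid_high_in M) pM h; rewrite rp; lia.
by move: between; case: (p) => a b; rewrite /val_lt /=; clear; lia.
Qed.

(** Exchanging the central points before ranking exchanges two consecutive values: a left
    multiplication by an adjacent transposition. *)
Lemma word_tauE M : word_tau M = [seq swap_adj (rank M (M, M)) x | x <- word_pi M].
Proof.
rewrite -map_comp; apply/eq_in_map => p; rewrite mem_sort => pM /=.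
have rank_inj q r : q \in diamond M -> r \in diamond M -> (rank M q == rank M r) = (q == r).
  rewrite -!mem_by_val => qM rM; apply/eqP/eqP => [e|->//].
  by rewrite -(nth_index q qM) [index q _]e nth_index.
rewrite /swap_adj -rank_mid !rank_inj ?mid_low_in ?mid_high_in // /mid_swap.
by case: eqP => // _; case: eqP.
Qed.

(** * Padding and asymptotics *)

Lemma rsk_ins_lt N t x : x < N -> all (all (gtn N)) t -> all (all (gtn N)) (rsk_ins t x).
Proof.
elim: t x => [|r t IHt] x xN; first by rewrite /= xN.
move=> /andP[rN tN]; rewrite rsk_ins_cons /=.
have {}tN : all (all (gtn N)) t := tN.
have fs := find_size (ltn x) r.
apply/andP; split.
  apply/(all_nthP 0) => i; rewrite size_rowins nth_rowins => ir.
  case: eqVneq => // ni; apply: (all_nthP 0 rN); move: fs ir ni; clear; lia.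
case: eqP => // nf; apply: IHt => //; apply: (all_nthP 0 rN); move: fs nf; clear; lia.
Qed.

Lemma rsk_lt N w : all (gtn N) w -> all (all (gtn N)) (rsk w).
Proof.
elim/last_ind: w => // w x IHw; rewrite all_rcons => /andP[xN /IHw].
by rewrite rsk_rcons; apply: rsk_ins_lt.
Qed.

Lemma foldl_rsk_ins_iota N s r t : all (gtn N) r ->
  foldl rsk_ins (r :: t) (iota N s) = (r ++ iota N s) :: t.
Proof.
elim: s N r => [|s IHs] N r rN; first by rewrite cats0.
have nN : ~~ has (ltn N) r.
  by rewrite -all_predC; apply: sub_all rN => x /=; rewrite -leqNgt; apply: ltnW.
have -> : foldl rsk_ins (r :: t) (iota N s.+1) = foldl rsk_ins (rcons r N :: t) (iota N.+1 s).
  rewrite -[iota N s.+1]/(N :: iota N.+1 s) /= -/(find (ltn N) r).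
  by move: nN; rewrite has_find -leqNgt => h; rewrite eqn_leq find_size h.
rewrite IHs ?cat_rcons // all_rcons /= ltnSn.
by apply: sub_all rN => x /=; apply: leqW.
Qed.

(** The appended letters increase and exceed all others, so they only lengthen the first row. Two
    shapes padded alike differ as much as before, which carries the example to larger [n]. *)
Lemma word_shape_pad N s w j : w != [::] -> all (gtn N) w ->
  nth 0 (word_shape (w ++ iota N s)) j = nth 0 (word_shape w) j + (j == 0) * s.
Proof.
move=> w0 wN; have := rsk_lt wN; rewrite /word_shape /rsk foldl_cat -/(rsk w).
have : rsk w != [::].
  case/lastP: w w0 {wN} => // w x _; rewrite rsk_rcons.
  by have [t' ->] := rsk_ins_head (rsk w) x.
case: (rsk w) => // r t _ /andP[rN _]; rewrite foldl_rsk_ins_iota //.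
by case: j => [|j] /=; rewrite ?size_cat ?size_iota ?mul1n ?mul0n ?addn0.
Qed.

(** * From words to permutations at distance one *)

Lemma exists_perm_one_line n w : perm_eq w (iota 0 n) -> exists p : {perm 'I_n}, one_line p = w.
Proof.
move=> pw; have sw : size w = n by rewrite (perm_size pw) size_iota.
have ltw (i : 'I_n) : nth 0 w i < n.
  by have := mem_nth 0 (_ : i < size w); rewrite sw (perm_mem pw) mem_iota; apply.
have finj : injective (fun i => Ordinal (ltw i)).
  move=> i j /(congr1 val) /= /eqP; rewrite nth_uniq ?sw //; first by move/eqP/val_inj.
  by rewrite (perm_uniq pw) iota_uniq.
exists (perm finj); apply: (@eq_from_nth _ 0); rewrite size_map size_enum_ord ?sw // => i ltin.
by rewrite (nth_map (Ordinal ltin)) ?size_enum_ord // permE /= nth_enum_ord.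
Qed.

Lemma one_line_adj_left n k (p : {perm 'I_n}) : k.+1 < n ->
  one_line (adj_left k p) = [seq swap_adj k x | x <- one_line p].
Proof.
move=> ltk; rewrite /adj_left; case: eqP => // h; rewrite /one_line -[RHS]map_comp.
apply: eq_map => i; rewrite /= permM /swap_adj.
case: tpermP => [->|->|/eqP n1 /eqP n2] /=; rewrite ?eqxx //.
  by case: eqP => // e; rewrite -[RHS]e; lia.
by rewrite -!val_eqE /= in n1 n2; rewrite (negbTE n1) (negbTE n2).
Qed.

Lemma adj_dist_adj_left n k (p : {perm 'I_n}) : k.+1 < n -> adj_dist_is p (adj_left k p) 1.
Proof.
move=> ltk; split; first by exists [:: k]; rewrite /= ltk.
(* At distance 0 the word would be fixed by exchanging the values [k] and [k + 1], although [k]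
   occurs in it. *)
case=> // _ [[|? ?] [// _ [_ /= e]]]; have := congr1 (@one_line n) e.
rewrite one_line_adj_left // => /eqP; rewrite eq_sym => /eqP es.
have kin : k \in one_line p.
  apply/mapP; exists (p^-1%g (Ordinal (ltnW ltk))); first by rewrite mem_enum.
  by rewrite permKV.
move: es; rewrite -{2}[one_line p]map_id => /eq_in_map/(_ k kin).
by rewrite /swap_adj eqxx; clear; lia.
Qed.

Lemma natdistDr a b s : natdist (a + s) (b + s) = natdist a b.
Proof. by rewrite /natdist !subnDr. Qed.

Lemma rsk_shapeE n (p : {perm 'I_n}) : rsk_shape p = word_shape (one_line p).
Proof. by []. Qed.

Lemma exists_adjacent_pair M n : 2 * (M.+1 * M.+1) <= n ->
  exists pi tau : {perm 'I_n}, adj_dist_is pi tau 1 /\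
    M.+1.*2 <= \sum_(j < n) natdist (nth 0 (rsk_shape pi) j) (nth 0 (rsk_shape tau) j).
Proof.
set N := 2 * _ => leNn; set k := rank M (M, M).
have ltkN : k.+1 < N by rewrite /k -rank_mid rank_size ?mid_high_in.
have ppi := word_pi_perm M.
have [|p ep] := @exists_perm_one_line n (word_pi M ++ iota N (n - N)).
  by rewrite -{2}(subnKC leNn) iotaD perm_cat2r.
have ltkn : k.+1 < n := leq_trans ltkN leNn.
exists p, (adj_left k p); split; first exact: adj_dist_adj_left.
have etau : one_line (adj_left k p) = word_tau M ++ iota N (n - N).
  rewrite one_line_adj_left // ep map_cat -word_tauE; congr (_ ++ _).
  rewrite -[RHS]map_id; apply/eq_in_map => x; rewrite mem_iota /swap_adj => /andP[Nx _].
  by rewrite !gtn_eqF //; apply: leq_trans Nx => //; apply: ltnW.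
have lt_pi : all (gtn N) (word_pi M).
  by apply/allP => x; rewrite (perm_mem ppi) mem_iota.
have lt_tau : all (gtn N) (word_tau M).
  apply/allP => _ /mapP[q + ->]; rewrite mem_sort => qM.
  by rewrite /= rank_size // mid_swap_diamond.
have ne_pi : word_pi M != [::] by rewrite -size_eq0 (perm_size ppi) size_iota.
have ne_tau : word_tau M != [::] by rewrite -size_eq0 size_map -(size_map (rank M)) size_eq0.
have le2n : M.+1.*2 <= n by apply: leq_trans leNn; rewrite /N; clear; nia.
rewrite !rsk_shapeE ep etau.
under eq_bigr do rewrite !word_shape_pad // natdistDr.
have := sum_natdist_ge (@psum_odd M) (@psum_even M).
rewrite -!(big_mkord xpredT (fun j => natdist (nth 0 _ j) (nth 0 _ j))) => h.
(* Only the first [2(M+1)] rows are counted; the remaining summands are nonnegative. *)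
by rewrite (big_cat_nat (n := M.+1.*2)) //=; apply: leq_trans h (leq_addr _ _).
Qed.

Lemma exists_double_square n : 1 < n -> exists M, 2 * (M.+1 * M.+1) <= n < 2 * (M.+2 * M.+2).
Proof.
elim: n => // n IHn; rewrite ltnS leq_eqVlt => /orP[/eqP<-|/IHn[M /andP[h1 h2]]]; first by exists 0.
have [le|lt] := leqP (2 * (M.+2 * M.+2)) n.+1; last by exists M; rewrite lt leqW.
by exists M.+1; rewrite le /=; move: h2; clear; lia.
Qed.

(** * The asymptotic bound *)

Local Open Scope R_scope.

Lemma sqrt_half_lt (M n : nat) : (n < 2 * (M.+2 * M.+2))%nat -> sqrt (INR n / 2) - 1 <= INR M.+1.
Proof.
move=> /ltP /lt_INR; rewrite -!multE !mult_INR -[INR 2]/2 (S_INR M.+1) => h.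
have M0 := pos_INR M.+1.
have : sqrt (INR n / 2) <= sqrt ((INR M.+1 + 1) * (INR M.+1 + 1)) by apply: sqrt_le_1_alt; lra.
by rewrite sqrt_square; lra.
Qed.

Lemma inv_sqrt_half_cv : Un_cv (fun n => / sqrt (INR n / 2)) 0.
Proof.
move=> e e0; have e2 : 0 < / (e * e) by apply: Rinv_0_lt_compat; nra.
have [N hN] := INR_unbounded (2 * / (e * e)).
exists N => n /le_INR Nn; rewrite /R_dist Rminus_0_r.
have lt : / (e * e) < INR n / 2 by lra.
have : / e < sqrt (INR n / 2).
  rewrite -(sqrt_square (/ e)); last by left; apply: Rinv_0_lt_compat.
  by apply: sqrt_lt_1_alt; rewrite -Rinv_mult; lra.
have ie0 := Rinv_0_lt_compat e e0 => h.
rewrite Rabs_pos_eq; last by left; apply: Rinv_0_lt_compat; lra.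
by rewrite -(Rinv_inv e); apply: Rinv_lt_contravar => //; apply: Rmult_lt_0_compat; lra.
Qed.

Theorem theorem3 :
  exists eps : nat -> R,
    (forall n, 0 <= eps n) /\ Un_cv eps 0 /\
    forall n : nat, (2 <= n)%nat ->
      exists pi tau : {perm 'I_n},
        adj_dist_is pi tau 1 /\
        (1 - eps n) * sqrt (INR n / 2) <= DeltaPart n (rsk_shape pi) (rsk_shape tau).
Proof.
(* For [n >= 2] this choice turns the left side into [sqrt(n/2) - 1], which is at most [M + 1] for
   the largest diamond with [2(M+1)^2 <= n]. *)
exists (fun n => / sqrt (INR n / 2)); split.
  (* At [n = 0] the square root vanishes, and the inverse of zero is zero by convention. *)
  move=> n; have [s0|<-] := sqrt_pos (INR n / 2); last by rewrite Rinv_0; lra.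
  by left; apply: Rinv_0_lt_compat.
split; first exact: inv_sqrt_half_cv.
move=> n n2; have [M /andP[lo hi]] := exists_double_square n2.
have [p [t [dist le]]] := exists_adjacent_pair lo.
exists p, t; split => //.
have n0 : 0 < INR n by apply: lt_0_INR; apply/ltP; apply: leq_trans n2.
have s0 : 0 < sqrt (INR n / 2) by apply: sqrt_lt_R0; lra.
rewrite Rmult_minus_distr_r Rinv_l; last lra.
have := sqrt_half_lt hi; rewrite /DeltaPart.
move/leP/le_INR: le; rewrite -mul2n -multE mult_INR -[INR 2]/2.
lra.
Qed.
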